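(* For every positive integer $n$, $$\sum_{m\in\mathbb Z}(-1)^m p_2\!\left(\frac{n-P_5(m)}{5}\right)\begin{cases}>0&\text{if }n\equiv 0\pmod 5,\\ <0&\text{if }n\equiv 1,2\pmod 5,\\ =0&\text{if }n\equiv 3,4\pmod 5.\end{cases}$$
   Context: For $n\in\mathbb N_0$, $p_2(n)$ denotes the number of $2$-colored partitions of $n$ (so $\sum_{n\ge0}p_2(n)q^n=\prod_{j\ge1}(1-q^j)^{-2}$, $p_2(0)=1$), and $p_2(x):=0$ for $x\notin\mathbb N_0$. For $m\in\mathbb Z$, $P_5(m):=\frac{3m^2-m}{2}$ is the $m$-th generalized pentagonal number. The sum over $m$ has only finitely many nonzero terms. *)

(* Defs.v *)
From HB Require Import structures.
From mathcomp Require Import all_boot all_order all_algebra.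
From mathcomp Require Import classical_sets cardinality fsbigop.
From mathcomp Require Import zify.
Set Implicit Arguments.
Unset Strict Implicit.
Unset Printing Implicit Defensive.
Import Order.TTheory GRing.Theory Num.Theory.
Local Open Scope ring_scope.

(* A 2-colored partition of [n] is encoded by its multiplicities: [f (c, j)] is
   the number of parts of size [j.+1] and color [c].  Part sizes and
   multiplicities in a partition of [n] are at most [n], so the bounds lose
   nothing. *)
Definition colored_partitions2 (n : nat) : {set {ffun 'I_2 * 'I_n -> 'I_n.+1}} :=
  [set f : {ffun 'I_2 * 'I_n -> 'I_n.+1}
     | (\sum_cj f cj * (cj.2).+1)%N == n].

Definition p2 (n : nat) : nat := #|colored_partitions2 n|.

Definition p2Q (x : rat) : int :=
  if x \is a Num.nat then (p2 (Num.truncn x))%:Z else 0.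

Definition P5 (m : int) : rat := (3 * m%:Q ^+ 2 - m%:Q) / 2.

Definition pent_term (n : nat) (m : int) : int :=
  (-1) ^ m * p2Q ((n%:Q - P5 m) / 5).

(* [\sum_(m \in A)] over a classical set ranges over the support of the summand
   and is 0 by convention when that support is infinite; by
   [pent_term_finite_support] below, this case never occurs here. *)
Definition pent_sum (n : nat) : int :=
  \sum_(m \in [set: int]%classic) pent_term n m.

Lemma pent_term_neq0 (n : nat) (m : int) :
  pent_term n m != 0 -> (- n%:Z <= m <= n%:Z)%R.
Proof.
rewrite /pent_term mulf_eq0 negb_or => /andP[_].
rewrite /p2Q; case: ifP => [x_nat _|]; last by rewrite eqxx.
have := natr_ge0 x_nat.
rewrite pmulr_lge0 ?invr_gt0 // subr_ge0 /P5 ler_pdivrMr //.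
have -> : 3 * m%:Q ^+ 2 - m%:Q = (3 * m ^+ 2 - m)%:Q.
  by rewrite rmorphB rmorphM rmorphXn.
have -> : n%:Q * 2 = (n%:Z * 2)%:Q by rewrite rmorphM.
rewrite ler_int; nia.
Qed.

Lemma pent_term_finite_support (n : nat) :
  finite_set [set m : int | pent_term n m != 0]%classic.
Proof.
apply: (@sub_finite_set _ _
  [set` [seq i%:Z - n%:Z | i <- iota 0 n.*2.+1]]%classic); last first.
  exact: finite_seq.
move=> m /pent_term_neq0 Hm.
change (m \in [seq i%:Z - n%:Z | i <- iota 0 n.*2.+1]); apply/mapP.
by exists (absz (m + n%:Z)); [rewrite mem_iota; lia | lia].
Qed.

(* Main.v *)
Require Import Defs.
From mathcomp Require Import all_boot all_order all_algebra.
From mathcomp Require Import classical_sets fsbigop.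
From mathcomp Require Import zify ring.
Set Implicit Arguments.
Unset Strict Implicit.
Unset Printing Implicit Defensive.
Import Order.TTheory GRing.Theory Num.Theory.
Local Open Scope ring_scope.

(** Write f_k for the product of the 1 - q^(kj) over j >= 1.  By Euler's
pentagonal number theorem the sum at n is the coefficient of q^n in f_1 /
f_5^2.  The factor 1 / f_5^2 is a series in q^5, so only the pentagonal theta
series, the sum of (-1)^m q^(P_5 m), has to be split modulo 5, according to m
modulo 5 ([pentagonal_dissection]).  The exponent P_5(m) is 0, 1 or 2 modulo 5,
whence the zeros for n = 3, 4 modulo 5.  The part with residue 1 comes from one
class of m; it is minus a pentagonal series again, that is -q f_25.  The parts
with residues 0 and 2 each come from two classes of m, and each pair is a
quintuple product.  With q in place of q^5, the three quotients by f_1^2 are,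
up to a minus sign for the residues 1 and 2,

  - f_5 / f_1^2 for the residue 1, and
  - f_5 (-q^a, -q^(5-a); q^5) (q^(5-2a), q^(5+2a); q^10) / f_1^2, with a = 1
    for the residue 0 and a = 2 for the residue 2.

All the factors 1 - q^i left in the numerators are pairwise distinct factors of
f_1, so they cancel against one of the two copies of f_1.  What remains is a
product of factors 1 + q^i and 1 / (1 - q^i), in which 1 / (1 - q) occurs: all
its coefficients are positive ([quintuple_quotient], [pentagonal_quotient],
[outer_class_coef_gt0], [middle_class_coef_gt0]).

The quintuple product with base q^b is derived from the Jacobi triple product:
the product of two triple products, with bases q^b and q^(2b) and summation
indices m and n, is regrouped by s = m + 2n.  For s = 3t + r the exponent
separates into a function of t plus one of u = n - t.  The inner sum over u is
f_(2b) when r is 0 or 1, and vanishes when r = 2; dividing by f_(2b) gives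
[quintuple_product].  The triple product in turn is the limit of a finite
identity with Gaussian binomials ([finite_triple_product]).

Power series are replaced by a nilpotent element: every identity is proved for
an element x of an arbitrary commutative ring with x^N = 0.  There all infinite
products and all theta series are finite, 1 - x^i is invertible for i > 0, and
identities are exact.  Applied to the class of X modulo X^N they give back the
coefficients of index below N ([eq_coef_nilpotent]). *)

(** * Sums over the integers *)

Local Notation "\zsum_ m F" := (\sum_(m \in [set: int]%classic) F)
  (at level 41, m name, F at level 41) : ring_scope.

Definition zrange (M : nat) : seq int := [seq k%:Z - M%:Z | k <- iota 0 (M + M).+1].

Lemma mem_zrange M m : (m \in zrange M) = (`|m| <= M)%N.
Proof.
apply/mapP/idP => [[k]|mM]; first by rewrite mem_iota => ? ->; lia.
by exists (absz (m + M%:Z)); [rewrite mem_iota; lia | lia].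
Qed.

Lemma zrange_uniq M : uniq (zrange M).
Proof. by rewrite map_inj_uniq ?iota_uniq // => i j; lia. Qed.

Section IntegerSums.
Variable R : comNzRingType.

Lemma fsum_seq (I : choiceType) (r : seq I) (f : I -> R) : uniq r ->
  (forall i, i \notin r -> f i = 0) ->
  \sum_(i \in [set: I]%classic) f i = \sum_(i <- r) f i.
Proof.
move=> ur f0; rewrite (@fsbigE _ _ _ _ _ r) // => [|i _ /f0 //].
by apply: eq_bigl => i; apply: mem_set.
Qed.

Lemma zsumE M (f : int -> R) : (forall m, (M < `|m|)%N -> f m = 0) ->
  \zsum_m f m = \sum_(m <- zrange M) f m.
Proof.
move=> f0; apply: fsum_seq (zrange_uniq M) _ => m.
by rewrite mem_zrange -ltnNge => /f0.
Qed.

Lemma zsum_ord M (f : int -> R) : (forall m, (M < `|m|)%N -> f m = 0) ->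
  \zsum_m f m = \sum_(k < (M + M).+1) f (k%:Z - M%:Z).
Proof.
move=> /zsumE->; rewrite big_map.
by rewrite -(big_mkord xpredT (fun k => f (k%:Z - M%:Z))) /index_iota subn0.
Qed.

Lemma zsum_mul M (f g : int -> R) : (forall m, (M < `|m|)%N -> f m = 0) ->
  (forall m, (M < `|m|)%N -> g m = 0) ->
  (\zsum_m f m) * (\zsum_m g m) =
  \sum_(p \in [set: int * int]%classic) f p.1 * g p.2.
Proof.
move=> f0 g0; rewrite (zsumE f0) (zsumE g0) big_distrlr /=.
rewrite (@fsum_seq _ (allpairs pair (zrange M) (zrange M))).
- by rewrite big_allpairs.
- by rewrite allpairs_uniq ?zrange_uniq // => -[a b] [c d].
case=> i j; have [/f0 f_i|iM] := ltnP M `|i|; first by rewrite /= f_i mul0r.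
have [/g0 g_j|jM] := ltnP M `|j|; first by rewrite /= g_j mulr0.
by move/negP; case; apply: (allpairs_f pair); rewrite mem_zrange.
Qed.

Lemma fsum_ord_pair (J : choiceType) d (s : seq J) (F : 'I_d * J -> R) :
  uniq s -> (forall i j, j \notin s -> F (i, j) = 0) ->
  \sum_(p \in [set: 'I_d * J]%classic) F p =
  \sum_(i < d) \sum_(j \in [set: J]%classic) F (i, j).
Proof.
move=> us s0; rewrite (@fsum_seq _ (allpairs pair (enum 'I_d) s)).
- rewrite big_allpairs big_enum; apply: eq_bigr => i _.
  by rewrite (fsum_seq us) // => j; exact: s0.
- by rewrite allpairs_uniq ?enum_uniq // => -[a b] [c e].
case=> i j; apply: contraNeq => Fij; apply: (allpairs_f pair); rewrite ?mem_enum //.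
by apply: contraNT Fij => /s0->.
Qed.

Lemma zsum_shift c (f : int -> R) : \zsum_m f m = \zsum_m f (m + c).
Proof.
by apply: reindex_fsbigT; exists (fun m => m - c) => m; rewrite ?addrK ?subrK.
Qed.

Lemma zsum_opp (f : int -> R) : \zsum_m f m = \zsum_m f (- m).
Proof. by apply: reindex_fsbigT; exists -%R; exact: opprK. Qed.

Lemma zsum_scale M c (f : int -> R) : (forall m, (M < `|m|)%N -> f m = 0) ->
  \zsum_m (c * f m) = c * \zsum_m f m.
Proof.
move=> f0; rewrite (zsumE f0) big_distrr /=.
by apply: zsumE => m mM; rewrite f0 ?mulr0.
Qed.

Lemma zsum_split d M (f : int -> R) : (0 < d)%N ->
  (forall m, (M < `|m|)%N -> f m = 0) ->
  \zsum_m f m = \sum_(r < d) \zsum_t f (d%:Z * t + r%:Z).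
Proof.
move=> d0 f0; pose h (p : 'I_d * int) : int := d%:Z * p.2 + p.1%:Z.
rewrite (@reindex_fsbigT _ _ _ _ _ h); last first.
  have g_lt m : (`|(m %% d%:Z)%Z| < d)%N by lia.
  exists (fun m => (Ordinal (g_lt m), (m %/ d%:Z)%Z)); last by move=> m /=; rewrite /h /=; lia.
  case=> r t; have rd : (0 <= r%:Z < `|d%:Z|) by have := ltn_ord r; lia.
  rewrite /h /=; congr pair; [apply: val_inj => /=|]; rewrite mulrC.
    by rewrite modzMDl modz_small.
  by rewrite divzMDl ?divz_small ?addr0 //; lia.
rewrite (fsum_ord_pair (zrange_uniq M.+1)) // => r t.
rewrite mem_zrange -ltnNge => tM; apply: f0.
have rd := ltn_ord r; have /= dt := abszM d%:Z t.
have : (d * M.+2 <= d * `|t|)%N by rewrite leq_mul.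
have : (1 * M.+1 <= d * M.+1)%N by rewrite leq_mul.
rewrite /h /=; lia.
Qed.

Lemma fsum_add (I : choiceType) (r : seq I) (f g : I -> R) :
  uniq r -> (forall i, i \notin r -> f i = 0) ->
  (forall i, i \notin r -> g i = 0) ->
  \sum_(i \in [set: I]%classic) (f i + g i) =
  \sum_(i \in [set: I]%classic) f i + \sum_(i \in [set: I]%classic) g i.
Proof.
move=> ur f0 g0; rewrite (fsum_seq ur f0) (fsum_seq ur g0) -big_split /=.
by apply: fsum_seq => // i ir; rewrite f0 ?g0 ?addr0.
Qed.

(** The involution u -> 1 - u has no fixed point: it exchanges u > 0 with
u <= 0.  So the two halves cancel, over any ring, even where 2 is a zero
divisor. *)
Lemma fsum_antisym M (f : int * int -> R) :
  (forall t u, (M < `|t|)%N || (M < `|u|)%N -> f (t, u) = 0) ->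
  (forall t u, f (t, 1 - u) = - f (t, u)) ->
  \sum_(p \in [set: int * int]%classic) f p = 0.
Proof.
move=> f0 fN; pose g (p : int * int) : R := if 0 < p.2 then f p else 0.
pose s (p : int * int) : int * int := (p.1, 1 - p.2).
have sI : bijective s by exists s => -[t u]; rewrite /s /= subKr.
transitivity (\sum_(p \in [set: int * int]%classic) (g p - g (s p))).
  apply: eq_fsbigr => -[t u] _; rewrite /g /s /=.
  have [u0|u0] := ltP 0 u; first by rewrite ifF ?subr0 //; lia.
  by rewrite ifT ?fN ?sub0r ?opprK //; lia.
pose box := allpairs pair (zrange M.+1) (zrange M.+1).
have box0 (F : int * int -> R) : (forall t u, (M.+1 < `|t|)%N || (M.+1 < `|u|)%N -> F (t, u) = 0) ->
    forall p, p \notin box -> F p = 0.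
  move=> F0 [t u] tu; apply: F0; apply: contraNT tu; rewrite negb_or -!leqNgt.
  by move=> /andP[tM uM]; apply: (allpairs_f pair); rewrite mem_zrange.
have ub : uniq box by rewrite allpairs_uniq ?zrange_uniq // => -[? ?] [? ?].
have g0 t u : (M < `|t|)%N || (M < `|u|)%N -> g (t, u) = 0.
  by move=> tu; rewrite /g f0 // if_same.
rewrite (fsum_add ub); first 1 last.
- by apply: box0 => t u tu; apply: g0; lia.
- by apply: box0 => t u tu; rewrite /s g0 ?oppr0 //=; lia.
have -> : \sum_(p \in [set: int * int]%classic) - g (s p) =
    - \sum_(p \in [set: int * int]%classic) g (s p).
  rewrite -mulN1r; under eq_fsbigr do rewrite -mulN1r.
  have gs0 : forall p, p \notin box -> g (s p) = 0.
    by apply: box0 => t u tu; rewrite /s g0 //=; lia.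
  rewrite (fsum_seq ub gs0) big_distrr; apply: fsum_seq => // p pb.
  by rewrite gs0 ?mulr0.
by rewrite -(@reindex_fsbigT _ _ _ _ _ s g sI) subrr.
Qed.

End IntegerSums.

(** * Gaussian binomials *)

Section GaussianBinomials.
Variables (R : comNzRingType) (q : R).

(** The Gaussian binomial coefficient, by Pascal's rule: the closed form
[qbin_poch] is a quotient, which makes no sense for an arbitrary q. *)
Fixpoint qbin (n k : nat) : R :=
  match n, k with
  | _, 0 => 1
  | 0, _.+1 => 0
  | n'.+1, k'.+1 => qbin n' k' + q ^+ k'.+1 * qbin n' k'.+1
  end.

Lemma qbin0 n : qbin n 0 = 1. Proof. by case: n. Qed.

Lemma qbinS n k : qbin n.+1 k.+1 = qbin n k + q ^+ k.+1 * qbin n k.+1.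
Proof. by []. Qed.

Lemma qbin_small n k : (n < k)%N -> qbin n k = 0.
Proof.
elim: n k => [|n IH] [|k] //= nk.
by rewrite !IH ?mulr0 ?addr0 // ltnW.
Qed.

(** The second Pascal rule, in which the power of q sits on the other term.
Both are needed because the finite triple product grows at both ends. *)
Lemma qbinSr n k : (k <= n)%N ->
  qbin n.+1 k.+1 = qbin n k.+1 + q ^+ (n - k) * qbin n k.
Proof.
elim: n k => [|n IH] [|k] //.
- by move=> _; rewrite qbinS /= mulr0 mul1r addr0 add0r.
- move=> _; rewrite [LHS]qbinS [in LHS]IH // [qbin n.+1 1]qbinS !qbin0 !subn0.
  by rewrite [q ^+ n.+1]exprS; ring.
move=> kn; rewrite [LHS]qbinS.
have [kn'|nk] := leqP k.+1 n; last first.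
  have ->: k = n by lia.
  rewrite (@qbin_small n.+1 n.+2) // subnn; ring.
rewrite [in LHS](IH k) // [in LHS](IH k.+1) // [in RHS]qbinS [in RHS]qbinS subSS.
have -> : (n - k)%N = (n - k.+1).+1 by lia.
rewrite !exprS; ring.
Qed.

(** The effect on a sum of Gaussian binomials of multiplication by one more
factor of the triple product: [qbin_suml] for a factor with a negative power
of the variable, which shifts the range to the left, and [qbin_sumr] for one
with a positive power. *)
Lemma qbin_suml n (G : nat -> R) :
  \sum_(k < n.+1) qbin n k * (G k.+1 + q ^+ k * G k) =
  \sum_(k < n.+2) qbin n.+1 k * G k.
Proof.
under eq_bigr do rewrite mulrDr.
rewrite big_split /= [in RHS]big_ord_recl [X in _ + X]big_ord_recl /=.
under [in RHS]eq_bigr do rewrite /bump /= add1n mulrDl.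
rewrite big_split /= [X in _ = _ + (_ + X)]big_ord_recr /=.
rewrite (@qbin_small n n.+1) // mulr0 mul0r addr0 !qbin0.
rewrite addrCA !mul1r; congr (_ + (_ + _)).
by apply: eq_bigr => i _; rewrite /bump /= add1n mulrCA mulrA.
Qed.

Lemma qbin_sumr n (G : nat -> R) :
  \sum_(k < n.+1) qbin n k * (G k + q ^+ (n - k) * G k.+1) =
  \sum_(k < n.+2) qbin n.+1 k * G k.
Proof.
under eq_bigr do rewrite mulrDr.
rewrite big_split /= [in RHS]big_ord_recl [X in X + _]big_ord_recl /=.
under [in RHS]eq_bigr => k _.
  rewrite /bump /= add1n -[_ + _]/(qbin n.+1 k.+1) qbinSr -1?ltnS // mulrDl.
  over.
rewrite big_split /= [X in _ = _ + (X + _)]big_ord_recr /=.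
rewrite (@qbin_small n n.+1) // mul0r addr0 !qbin0 -addrA.
congr (_ + (_ + _)).
by apply: eq_bigr => i _; rewrite mulrCA mulrA.
Qed.

Lemma qbin_poch n k : (k <= n)%N ->
  qbin n k * (\prod_(j < k) (1 - q ^+ j.+1) * \prod_(j < n - k) (1 - q ^+ j.+1))
  = \prod_(j < n) (1 - q ^+ j.+1).
Proof.
elim: n k => [|n IH] [|k] //.
- by rewrite !big_ord0 !mulr1.
- by rewrite qbin0 subn0 big_ord0 !mul1r.
rewrite ltnS => kn; rewrite qbinS subSS mulrDl [RHS]big_ord_recr /=.
rewrite big_ord_recr /=; have := IH k kn.
set A := \prod_(j < k) _; set B := \prod_(j < n - k) _ => IHk.
have -> : qbin n k * (A * (1 - q ^+ k.+1) * B) =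
  (1 - q ^+ k.+1) * \prod_(j < n) (1 - q ^+ j.+1) by rewrite -IHk; ring.
have [kn'|nk] := ltnP k n; last first.
  have -> : k = n by lia.
  by rewrite qbin_small //; ring.
have := IH k.+1 kn'; rewrite big_ord_recr /= -/A /B => IHk'.
have -> : (n - k)%N = (n - k.+1).+1 by lia.
rewrite big_ord_recr /=.
set P := \prod_(j < n) _ in IHk' *.
have nE : (n.+1 = k.+1 + (n - k.+1).+1)%N by lia.
rewrite [in q ^+ n.+1]nE exprD.
move: IHk'; set C := \prod_(j < _) _ => <-.
ring.
Qed.

End GaussianBinomials.

(** * The Jacobi triple product *)

Lemma sign_exp_parity (R : comNzRingType) (e : R) m n :
  e * e = 1 -> odd m = odd n -> e ^+ m = e ^+ n.
Proof.
move=> ee mn; rewrite -(odd_double_half m) -(odd_double_half n) mn !exprD.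
by rewrite -!mul2n !exprM !expr2 ee !expr1n.
Qed.

Definition tri (j : int) : int := (j * (j - 1) %/ 2)%Z.

Lemma triE j : tri j * 2 = j * (j - 1).
Proof.
apply: divzK; have /orP[c|c] : (2 %| j)%Z || (2 %| j - 1)%Z by lia.
  by rewrite dvdz_mulr.
by rewrite dvdz_mull.
Qed.

Lemma tri_ge0 j : 0 <= tri j.
Proof. have := triE j; nia. Qed.

Lemma tri_geN j : - j <= tri j.
Proof. have := triE j; nia. Qed.

(** The exponents b j(j-1)/2 + a j of the theta series attached to the
arithmetic progressions a and b - a modulo b. *)
Definition quad (a b : nat) (j : int) : int := b%:Z * tri j + a%:Z * j.

Lemma quadE a b j : quad a b j * 2 = b%:Z * (j * (j - 1)) + a%:Z * j * 2.
Proof. by rewrite /quad mulrDl -mulrA triE. Qed.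

Lemma quad_ge0 a b j : (a <= b)%N -> 0 <= quad a b j.
Proof. by rewrite /quad => ab; have := tri_ge0 j; have := tri_geN j; nia. Qed.

Section FiniteTripleProduct.
Variables (R : comNzRingType) (x e : R) (a b : nat).
Hypotheses (ee : e * e = 1) (ab : (a <= b)%N).

(** With e = 1 or e = -1 the power of e depends on the parity of j only, and
the exponent of x is nonnegative, so the absolute values are harmless. *)
Definition theta (j : int) : R := e ^+ `|j| * x ^+ `|quad a b j|.

(** The new factor multiplies the j-th theta term by a power of x^b times the
neighbouring theta term, because the exponent has the second difference b.
So each step is a Pascal rule. *)
Lemma finite_triple_product L M :
  \prod_(j < M) (1 + e * x ^+ (a + b * j)) *
  \prod_(j < L) (1 + e * x ^+ (b * j.+1 - a)) =
  \sum_(k < (L + M).+1) qbin (x ^+ b) (L + M) k * theta (k%:Z - L%:Z).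
Proof.
have triS j : tri (j + 1) = tri j + j.
  by apply: (@mulIf _ (2 : int)) => //; rewrite mulrDl !triE; ring.
have thS j c d (m : nat) : quad a b j + c%:Z = quad a b (j + d) + (b * m)%:Z -> `|d|%N = 1%N ->
   e * x ^+ c * theta j = (x ^+ b) ^+ m * theta (j + d).
  move=> E d1; have := quad_ge0 j ab; have := quad_ge0 (j + d) ab => q1 q2.
  rewrite /theta mulrACA -exprS -exprD mulrCA -exprM -exprD; congr (_ * _).
    by apply: sign_exp_parity => //; lia.
  by congr (_ ^+ _); lia.
elim: L => [|L IHL].
  rewrite big_ord0 mulr1 add0n; elim: M => [|M IHM].
    by rewrite big_ord0 big_ord1 mul1r subrr /theta /quad !mulr0 mulr1.
  rewrite big_ord_recr /= IHM big_distrl /= -(qbin_sumr _ _ (fun k => theta (k%:Z - 0%:Z))).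
  apply: eq_bigr => k _; rewrite -mulrA; congr (_ * _).
  rewrite mulrC mulrDl mul1r; congr (_ + _).
  rewrite (@thS _ _ 1 (M - k)%N) //; last first.
    by rewrite /quad triS; have := ltn_ord k; nia.
  by congr (_ * theta _); lia.
rewrite [X in _ * X]big_ord_recr /= mulrA IHL big_distrl /= addSn.
rewrite -(qbin_suml _ _ (fun k => theta (k%:Z - L.+1%:Z))).
apply: eq_bigr => k _; rewrite -mulrA; congr (_ * _).
rewrite mulrC mulrDl mul1r; congr (_ + _); first by congr theta; lia.
rewrite (@thS _ _ (-1) k) //; first by congr (_ * theta _); lia.
have := triS (k%:Z - L%:Z - 1); rewrite subrK /quad => ->; nia.
Qed.

End FiniteTripleProduct.

Lemma le_quad a b j : (0 < a < b)%N -> `|j| <= quad a b j.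
Proof.
by rewrite /quad => ab; have := tri_ge0 j; have := tri_geN j; nia.
Qed.

Lemma prod_progression (R : comNzRingType) (F : nat -> R) a b N :
  (0 < a <= b)%N ->
  \prod_(j < N) F (a + b * j)%N =
  \prod_(1 <= i < (b * N).+1 | (i %% b == a %% b)%N) F i.
Proof.
move=> /andP[a0 ab]; elim: N => [|N IH].
  by rewrite big_ord0 muln0 big_geq.
rewrite big_ord_recr /= IH [RHS](@big_cat_nat _ _ _ (b * N).+1) //=; last by rewrite ltnS leq_mul.
congr (_ * _); rewrite big_mkcond /=.
under eq_big_nat => i iN.
  have -> : (i %% b == a %% b)%N = (i == a + b * N)%N.
    have iE : i = (N * b + (i - b * N))%N by lia.
    rewrite [in LHS]iE modnMDl.
    have : (0 < i - b * N <= b)%N by lia.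
    have -> : (i == a + b * N)%N = (i - b * N == a)%N by lia.
    move: (i - b * N)%N => r rb.
    have [rb'|br] := ltnP r b; have [ab'|ba] := ltnP a b.
    - by rewrite !modn_small.
    - have -> : a = b by lia.
      by rewrite modnn modn_small //; lia.
    - have -> : r = b by lia.
      by rewrite modnn modn_small //; lia.
    have [-> ->] : r = b /\ a = b by lia.
    by rewrite !eqxx.
  over.
by rewrite -big_mkcond big_nat1_eq ifT //; nia.
Qed.

Section Products.
Variables (R : comNzRingType) (x : R) (N : nat).

(** One bound N truncates all sums and products, and it is also the nilpotency
index of x, so that these truncations have the exact properties of the
infinite objects: [geom] is 1 / (1 - x^i), and [parts_prod], the generating
function of the partitions with parts in P, is the inverse of [euler_prod]. *)
Definition geom (i : nat) : R := \sum_(k < N) x ^+ (i * k).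
Definition euler_prod (P : pred nat) : R := \prod_(1 <= i < N | P i) (1 - x ^+ i).
Definition parts_prod (P : pred nat) : R := \prod_(1 <= i < N | P i) geom i.
Definition poch (e : R) (a b : nat) : R := \prod_(j < N) (1 + e * x ^+ (a + b * j)).

Hypothesis xN : x ^+ N = 0.

Lemma nilpotent_expr m : (N <= m)%N -> x ^+ m = 0.
Proof. by move=> Nm; rewrite -(subnK Nm) exprD xN mulr0. Qed.

Lemma geomK i : (0 < i)%N -> (1 - x ^+ i) * geom i = 1.
Proof.
move=> i0; rewrite /geom; under eq_bigr do rewrite exprM.
rewrite -opprB mulNr -subrX1 -exprM nilpotent_expr ?sub0r ?opprK //.
by rewrite leq_pmull.
Qed.

Lemma euler_prodK P : euler_prod P * parts_prod P = 1.
Proof.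
rewrite /euler_prod /parts_prod -big_split big_nat_cond big1 // => i /andP[/andP[i0 _] _].
exact: geomK.
Qed.

Lemma euler_prod_widen M P : (N <= M)%N ->
  \prod_(1 <= i < M | P i) (1 - x ^+ i) = euler_prod P.
Proof.
move=> NM; rewrite /euler_prod; have [N0|N0] := posnP N.
  rewrite N0 [RHS]big_geq // big_nat_cond big1 // => i _.
  by rewrite nilpotent_expr ?N0 // subr0.
rewrite (@big_cat_nat _ _ _ N) //= [X in _ * X]big_nat_cond [X in _ * X]big1 ?mulr1 //.
by move=> i /andP[/andP[Ni _] _]; rewrite nilpotent_expr // subr0.
Qed.

Lemma euler_prod_progression M a b : (0 < a <= b)%N -> (N <= M)%N ->
  \prod_(j < M) (1 - x ^+ (a + b * j)) = euler_prod (fun i => i %% b == a %% b)%N.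
Proof.
move=> ab NM; rewrite (@prod_progression _ (fun i => 1 - x ^+ i)) //.
by apply: euler_prod_widen; nia.
Qed.

Lemma poch_neg a b : (0 < a <= b)%N ->
  poch (-1) a b = euler_prod (fun i => i %% b == a %% b)%N.
Proof.
move=> ab; rewrite -(@euler_prod_progression N) //.
by apply: eq_bigr => j _; rewrite mulN1r.
Qed.

(** The bound N on the factors is also the nilpotency index, so a larger bound
adds factors 1 only. *)
Lemma poch_widen M e a b : (0 < b)%N -> (N <= M)%N ->
  \prod_(j < M) (1 + e * x ^+ (a + b * j)) = poch e a b.
Proof.
move=> b0 NM; rewrite /poch -!(big_mkord xpredT (fun j => 1 + e * x ^+ (a + b * j))).
rewrite (@big_cat_nat _ _ _ N) //= [X in _ * X]big_nat_cond [X in _ * X]big1 ?mulr1 //.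
by move=> i /andP[/andP[Ni _] _]; rewrite nilpotent_expr ?mulr0 ?addr0 //; nia.
Qed.

Lemma theta_eq0 e a b j : (0 < a < b)%N -> (N <= `|j|)%N -> theta x e a b j = 0.
Proof.
move=> ab Nj; rewrite /theta nilpotent_expr ?mulr0 //.
by have := le_quad j ab; lia.
Qed.

(** In the finite identity with 2N factors on each side, only the terms with
|j| < N survive.  For these both lower indices of the Gaussian binomial are at
least N, so its three q-factorials all agree with the full product, and its
product with that full product is 1. *)
Lemma jacobi_triple_product e a b : e * e = 1 -> (0 < a < b)%N ->
  \zsum_j theta x e a b j =
  poch e a b * poch e (b - a) b * euler_prod (fun i => i %% b == 0)%N.
Proof.
move=> ee ab; pose P := fun i => (i %% b == 0)%N.
have euler_prodE n : (N <= n)%N -> \prod_(j < n) (1 - (x ^+ b) ^+ j.+1) = euler_prod P.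
  move=> Nn; have := @euler_prod_progression n b b; rewrite modnn => <- //; last by lia.
  by apply: eq_bigr => j _; rewrite -exprM mulnS.
rewrite -(@poch_widen (N + N) e a b) -?(@poch_widen (N + N) e (b - a) b); try lia.
under [X in _ * X * _]eq_bigr => j _.
  have -> : (b - a + b * j = b * j.+1 - a)%N by lia.
  over.
rewrite finite_triple_product //; last by lia.
rewrite (@zsum_ord _ (N + N)); last by move=> m Nm; apply: theta_eq0 => //; lia.
rewrite big_distrl; apply: eq_bigr => k _ /=.
have [jN|Nj] := ltnP `|k%:Z - (N + N)%N%:Z| N; last by rewrite !theta_eq0 // mulr0 mul0r.
have kN : (k <= N + N + (N + N))%N by lia.
have := qbin_poch (x ^+ b) kN; rewrite !euler_prodE; try lia.
set q := qbin _ _ _ => qE.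
suff qF : q * euler_prod P = 1 by rewrite mulrAC qF mul1r.
by rewrite -[LHS]mulr1 -(euler_prodK P) mulrA -[_ * _ * euler_prod P]mulrA qE.
Qed.
End Products.

(** * The quintuple product *)

Lemma absz_addn_eq (p q r s : int) : 0 <= p -> 0 <= q -> 0 <= r -> 0 <= s ->
  p + q = r + s -> (`|p| + `|q| = `|r| + `|s|)%N.
Proof. lia. Qed.

(** The triangular numbers in [quad] disappear when an identity between
exponents is doubled. *)
Local Ltac double_quads :=
  apply: (@mulIf _ (2 : int)) => //;
  rewrite [LHS]mulrDl [RHS]mulrDl ?[(quad _ _ _ + _%:Z) * _]mulrDl !quadE
    !(PoszD, PoszM); ring.
Section Theta.
Variables (R : comNzRingType) (x : R) (N : nat).
Hypothesis xN : x ^+ N = 0.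

(** The multiples of c are the numbers congruent to 0, c or 2c modulo 3c. *)
Lemma euler_prod_split3 c : (0 < c)%N ->
  euler_prod x N (fun i => i %% (3 * c) == (2 * c) %% (3 * c))%N *
  euler_prod x N (fun i => i %% (3 * c) == c %% (3 * c))%N *
  euler_prod x N (fun i => i %% (3 * c) == 0)%N = euler_prod x N (fun i => i %% c == 0)%N.
Proof.
move=> c0; have mod3 i : (i %% (3 * c) = c * ((i %/ c) %% 3) + i %% c)%N.
  have := ltn_pmod (i %/ c) (isT : 0 < 3)%N.
  have := ltn_pmod i c0; have := divn_eq i c; have := divn_eq (i %/ c) 3.
  set q := (_ %/ 3)%N; set r := (_ %% 3)%N; set s := (i %% _)%N => qE iE s2 r3.
  have -> : (i = q * (3 * c) + (c * r + s))%N by rewrite [LHS]iE qE; lia.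
  by rewrite modnMDl modn_small //; nia.
rewrite /euler_prod !(big_mkcond (fun _ => _ == _)) -!big_split; apply: eq_bigr => i _ /=.
rewrite mod3 (@modn_small (2 * c)) ?(@modn_small c); try lia.
have ic := ltn_pmod i c0; have := ltn_pmod (i %/ c) (isT : 0 < 3)%N.
move: (_ %% 3)%N (i %% _)%N ic => r s s2 r3.
have [->|[->|->]] : r = 0%N \/ r = 1%N \/ r = 2%N by lia.
all: by do 4?case: eqP => ?; rewrite ?mulr1 ?mul1r //; exfalso; lia.
Qed.

Lemma pentagonal_number_theorem c : (0 < c)%N ->
  \zsum_t theta x (-1) (2 * c) (3 * c) t = euler_prod x N (fun i => i %% c == 0)%N.
Proof.
move=> c0; rewrite (jacobi_triple_product xN) ?mulrNN ?mulr1 //; last by lia.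
have -> : (3 * c - 2 * c = c)%N by lia.
by rewrite !(poch_neg xN) ?euler_prod_split3 //; lia.
Qed.

(** The same series with t replaced by -t; both forms occur as inner sums of
the quintuple product. *)
Lemma pentagonal_number_theorem_reflected c : (0 < c)%N ->
  \zsum_t theta x (-1) c (3 * c) t = euler_prod x N (fun i => i %% c == 0)%N.
Proof.
move=> c0; rewrite zsum_opp -pentagonal_number_theorem //; apply: eq_fsbigr => t _.
by rewrite /theta abszN; congr (_ * _ ^+ `|_|); apply: (@mulIf _ (2 : int)) => //;
  rewrite !quadE !PoszM; ring.
Qed.

(** The second half of the quintuple product series, which comes from
m + 2n = 3t + 1.  Its exponent has the constant term a, and 2b + 3a may exceed
3b, so that [le_quad] does not bound it. *)
Definition theta_tail (a b : nat) (t : int) : R :=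
  (-1) ^+ `|t| * x ^+ `|quad (2 * b + 3 * a) (3 * b) t + a%:Z|.

Lemma le_quad_tail a b t : (0 < a)%N -> (2 * a < b)%N ->
  `|t| <= quad (2 * b + 3 * a) (3 * b) t + a%:Z.
Proof.
move=> a0 ab; rewrite /quad; have [t0|t0] := lerP 0 t.
  by have := tri_ge0 t; nia.
have tri3 : tri t * 2 = t * (t - 1) := triE t.
have [k kt] : exists k : nat, t = - k.+1%:Z by exists `|t|.-1; lia.
have triN : tri t = k%:Z + 1 + tri k.+1%:Z by have := triE k.+1%:Z; lia.
have tk : k%:Z <= tri k.+1%:Z by have := triE k.+1%:Z; nia.
rewrite kt in triN *; nia.
Qed.

Lemma theta_tail_eq0 a b t : (0 < a)%N -> (2 * a < b)%N -> (N <= `|t|)%N ->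
  theta_tail a b t = 0.
Proof.
move=> a0 ab Nt; rewrite /theta_tail (nilpotent_expr xN) ?mulr0 //.
by have := le_quad_tail t a0 ab; lia.
Qed.

(** The quintuple product identity with base x^b and variable -x^a.  The theta
series of the two triple products, multiplied by D, are multiplied out over
pairs (m, n) with m + 2n = 3t + r and n = t + u.  For r = 0 and r = 1 the
double sum factors, with D as the sum over u; for r = 2 the exponent is
invariant under u -> 1 - u while the sign changes. *)
Lemma quintuple_product a b : (0 < a)%N -> (2 * a < b)%N ->
  \zsum_t theta x (-1) (b + 3 * a) (3 * b) t + \zsum_t theta_tail a b t =
  poch x N 1 a b * poch x N 1 (b - a) b * euler_prod x N (fun i => i %% b == 0)%N *
  (poch x N (-1) (b + 2 * a) (2 * b) * poch x N (-1) (b - 2 * a) (2 * b)).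
Proof.
move=> a0 ab; have b0 : (0 < b)%N by lia.
pose D := euler_prod x N (fun i => i %% (2 * b) == 0)%N.
suff E : (\zsum_t theta x (-1) (b + 3 * a) (3 * b) t + \zsum_t theta_tail a b t) * D =
  poch x N 1 a b * poch x N 1 (b - a) b * euler_prod x N (fun i => i %% b == 0)%N *
  (poch x N (-1) (b + 2 * a) (2 * b) * poch x N (-1) (b - 2 * a) (2 * b)) * D.
  set L := (X in X = _); set RR := (X in _ = X).
  by rewrite -[L]mulr1 -[RR]mulr1 -(euler_prodK xN (fun i => i %% (2 * b) == 0)%N) !mulrA E.
have NN : (-1) * (-1) = 1 :> R by rewrite mulrNN mulr1.
have sgD (t u : int) : (-1) ^+ `|t + u| = (-1) ^+ `|t| * (-1) ^+ `|u| :> R.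
  by rewrite -exprD; apply: sign_exp_parity => //; lia.
have -> : poch x N 1 a b * poch x N 1 (b - a) b * euler_prod x N (fun i => i %% b == 0)%N *
  (poch x N (-1) (b + 2 * a) (2 * b) * poch x N (-1) (b - 2 * a) (2 * b)) * D =
  (\zsum_m theta x 1 a b m) * (\zsum_n theta x (-1) (b + 2 * a) (2 * b) n).
  rewrite !(jacobi_triple_product xN) ?mulr1 //; try lia.
  have -> : (2 * b - (b + 2 * a) = b - 2 * a)%N by lia.
  by rewrite -!mulrA.
rewrite (@zsum_mul _ N); first 1 last.
- by move=> m Nm; rewrite (theta_eq0 xN) //; lia.
- by move=> m Nm; rewrite (theta_eq0 xN) //; lia.
(* The inverse takes r and t to be the remainder and quotient of m + 2n by 3. *)
pose h (p : 'I_3 * (int * int)) : int * int := (p.2.1 + p.1%:Z - 2 * p.2.2, p.2.1 + p.2.2).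
rewrite (@reindex_fsbigT _ _ _ _ _ h); last first.
  have g_lt (s : int) : (`|(s %% 3)%Z| < 3)%N by lia.
  exists (fun q => (Ordinal (g_lt (q.1 + 2 * q.2)),
    (((q.1 + 2 * q.2) %/ 3)%Z, q.2 - ((q.1 + 2 * q.2) %/ 3)%Z))).
    case=> r [t u]; have rd := ltn_ord r; rewrite /h /=.
    by congr pair; [apply: val_inj => /=; lia | congr pair; lia].
  by case=> m n; rewrite /h /=; congr pair; lia.
pose box := allpairs pair (zrange (N + N + 2)) (zrange (N + N + 2)).
pose F (r : int) (p : int * int) : R := theta x 1 a b (p.1 + r - 2 * p.2) *
  theta x (-1) (b + 2 * a) (2 * b) (p.1 + p.2).
have F0 (r : int) t u : 0 <= r < 3 -> (N + N + 2 < `|t|)%N || (N + N + 2 < `|u|)%N ->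
    F r (t, u) = 0.
  move=> r3 tu; rewrite /F /=; have [Nt|tN] := leqP N `|(t + r - 2 * u)%R|.
    by rewrite (theta_eq0 xN) ?mul0r //; lia.
  by rewrite [X in _ * X](theta_eq0 xN) ?mulr0 //; lia.
have ub : uniq box by rewrite allpairs_uniq ?zrange_uniq // => -[? ?] [? ?].
rewrite (fsum_ord_pair ub); last first.
  move=> r [t u] tu; apply: (F0 r%:Z); first by have := ltn_ord r; lia.
  apply: contraNT tu; rewrite negb_or -!leqNgt.
  by move=> /andP[tM uM]; apply: (allpairs_f pair); rewrite mem_zrange.
rewrite !big_ord_recl big_ord0 /= /bump /= addr0.
have F_prod (w v : int -> R) M r : (forall t, (M <= `|t|)%N -> w t = 0) ->
   (forall t, (M <= `|t|)%N -> v t = 0) -> (forall t u, F r (t, u) = w t * v u) ->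
   \sum_(p \in [set: int * int]%classic) F r p = (\zsum_t w t) * (\zsum_t v t).
  move=> w0 v0 Fwv; rewrite (@zsum_mul _ M); try by move=> m Mm; rewrite ?w0 ?v0 // ltnW.
  by apply: eq_fsbigr => -[t u] _; rewrite Fwv.
(* The r = 0 part: the first theta series times D. *)
have S0 : \sum_(p \in [set: int * int]%classic) F 0 p =
    (\zsum_t theta x (-1) (b + 3 * a) (3 * b) t) * D.
  rewrite (F_prod (theta x (-1) (b + 3 * a) (3 * b)) (theta x (-1) (4 * b) (6 * b)) N).
  - by rewrite /D -(@pentagonal_number_theorem (2 * b)) ?mulnA //; lia.
  - by move=> t Nt; rewrite (theta_eq0 xN) //; lia.
  - by move=> t Nt; rewrite (theta_eq0 xN) //; lia.
  move=> t u; rewrite /F /theta /= expr1n mul1r sgD.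
  rewrite mulrCA -(exprD x) [RHS]mulrACA -(exprD x); congr (_ * _ ^+ _).
  apply: absz_addn_eq; try by apply: quad_ge0; lia.
  by double_quads.
(* The r = 1 part: the tail series times D. *)
have S1 : \sum_(p \in [set: int * int]%classic) F 1 p = (\zsum_t theta_tail a b t) * D.
  rewrite (F_prod (theta_tail a b) (theta x (-1) (2 * b) (6 * b)) N).
  - by rewrite /D -(@pentagonal_number_theorem_reflected (2 * b)) ?mulnA //; lia.
  - by move=> t Nt; rewrite theta_tail_eq0.
  - by move=> t Nt; rewrite (theta_eq0 xN) //; lia.
  move=> t u; rewrite /F /theta /theta_tail /= expr1n mul1r sgD.
  rewrite mulrCA -(exprD x) [RHS]mulrACA -(exprD x); congr (_ * _ ^+ _).
  apply: absz_addn_eq; try by apply: quad_ge0; lia.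
    by have := le_quad_tail t a0 ab; lia.
  by double_quads.
have S2 : \sum_(p \in [set: int * int]%classic) F 2 p = 0.
  apply: (@fsum_antisym _ (N + N + 2)) => [t u tu|t u]; first by rewrite F0.
  rewrite /F /theta /= !expr1n !mul1r (sgD t u) (sgD t (1 - u)).
  rewrite [LHS]mulrCA -(exprD x) [X in _ = - X]mulrCA -(exprD x) -[RHS]mulNr; congr (_ * _ ^+ _).
    have -> : (-1) ^+ `|1 - u| = (-1) ^+ `|u|.+1 :> R.
      by apply: sign_exp_parity => //; lia.
    by rewrite exprS; ring.
  apply: absz_addn_eq; try by apply: quad_ge0; lia.
  by double_quads.
rewrite mulrDl -S0 -S1; symmetry; rewrite -[RHS]addr0 -addrA.
by congr (_ + (_ + _)); exact: S2.
Qed.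
End Theta.

(** * Dividing by the square of Euler's product *)

Section Quotients.
Variables (R : comNzRingType) (x : R) (N : nat).
Hypothesis xN : x ^+ N = 0.

Lemma euler_prodU P Q : (forall i, ~~ (P i && Q i)) ->
  euler_prod x N P * euler_prod x N Q = euler_prod x N (fun i => P i || Q i).
Proof.
move=> PQ; rewrite /euler_prod (big_mkcond P) (big_mkcond Q) (big_mkcond (fun i => P i || Q i)).
rewrite -big_split; apply: eq_bigr => i _ /=.
by have := PQ i; case: (P i); case: (Q i); rewrite ?mulr1 ?mul1r.
Qed.

(** One of the two copies of the partition generating function absorbs the
factors 1 - x^i with i in P; the other one stays whole and will provide the
strict positivity. *)
Lemma euler_prod_parts_prod2 P :
  euler_prod x N P * (parts_prod x N xpredT * parts_prod x N xpredT) =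
  parts_prod x N xpredT * parts_prod x N (predC P).
Proof.
have -> : parts_prod x N xpredT = parts_prod x N P * parts_prod x N (predC P) :> R.
  rewrite /parts_prod [RHS]mulrC (big_mkcond P) (big_mkcond (predC P)) -big_split.
  by apply: eq_bigr => i _ /=; case: (P i); rewrite ?mulr1 ?mul1r.
set p := parts_prod x N P; set q := parts_prod _ _ _.
have -> : euler_prod x N P * (p * q * (p * q)) = (euler_prod x N P * p) * (p * q * q) by ring.
by rewrite /p (euler_prodK xN) mul1r.
Qed.

End Quotients.

(** The indices i such that 1 - q^i occurs in the quintuple product of
base q^5 and variable -q^a. *)
Definition cancelled (a i : nat) : bool :=
  [|| i %% 5 == 0, i %% 10 == 5 + 2 * a | i %% 10 == 5 - 2 * a]%N.

(** The quotients by f_1^2 of the two kinds of residue classes, after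
cancellation, in a form that shows only products of series with nonnegative
coefficients. *)
Definition outer_class (R : comNzRingType) (a : nat) (x : R) (N : nat) : R :=
  parts_prod x N xpredT *
  (parts_prod x N (predC (cancelled a)) * (poch x N 1 a 5 * poch x N 1 (5 - a) 5)).

Definition middle_class (R : comNzRingType) (x : R) (N : nat) : R :=
  parts_prod x N xpredT * parts_prod x N (predC (fun i => i %% 5 == 0)%N).

Lemma euler_prod_cancelled (R : comNzRingType) a (x : R) N : (0 < a < 3)%N ->
  euler_prod x N (fun i => i %% 5 == 0)%N *
    (euler_prod x N (fun i => i %% (2 * 5) == (5 + 2 * a) %% (2 * 5))%N *
     euler_prod x N (fun i => i %% (2 * 5) == (5 - 2 * a) %% (2 * 5))%N) =
  euler_prod x N (cancelled a).
Proof.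
move=> a3; have [->|->] : a = 1%N \/ a = 2%N by lia.
all: by rewrite !euler_prodU => [|i|i]; try lia; apply: eq_bigl => i; rewrite /cancelled; lia.
Qed.

Lemma quintuple_quotient (R : comNzRingType) a (x : R) N :
  x ^+ N = 0 -> (0 < a < 3)%N ->
  (\zsum_t theta x (-1) (5 + 3 * a) 15 t + \zsum_t theta_tail x a 5 t) *
    (parts_prod x N xpredT * parts_prod x N xpredT) = outer_class a x N.
Proof.
move=> xN a3; have := @quintuple_product _ _ _ xN a 5; rewrite !(poch_neg xN); try lia.
move=> ->; try lia.
rewrite -[_ * _ * euler_prod _ _ _ * _]mulrA euler_prod_cancelled // -mulrA.
by rewrite euler_prod_parts_prod2 // mulrCA [X in _ * X]mulrC.
Qed.

Lemma pentagonal_quotient (R : comNzRingType) (x : R) N : x ^+ N = 0 ->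
  (\zsum_t theta x (-1) 10 15 t) * (parts_prod x N xpredT * parts_prod x N xpredT) =
  middle_class x N.
Proof.
move=> xN; rewrite (@pentagonal_number_theorem _ _ _ xN 5) //.
exact: euler_prod_parts_prod2.
Qed.

(** * From nilpotent elements back to coefficients *)

Section Morphisms.
Variables (R S : comNzRingType) (f : {rmorphism R -> S}) (x : R) (N : nat).

Lemma rmorph_geom i : f (geom x N i) = geom (f x) N i.
Proof. by rewrite rmorph_sum; apply: eq_bigr => k _; rewrite rmorphXn. Qed.

Lemma rmorph_parts_prod P : f (parts_prod x N P) = parts_prod (f x) N P.
Proof. by rewrite rmorph_prod; apply: eq_bigr => k _; rewrite rmorph_geom. Qed.

Lemma rmorph_poch a b : f (poch x N 1 a b) = poch (f x) N 1 a b.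
Proof.
rewrite rmorph_prod; apply: eq_bigr => k _.
by rewrite rmorphD !mul1r rmorph1 rmorphXn.
Qed.

Lemma rmorph_theta a b t : f (theta x (-1) a b t) = theta (f x) (-1) a b t.
Proof. by rewrite rmorphM !rmorphXn rmorphN1. Qed.

Lemma rmorph_outer_class a : f (outer_class a x N) = outer_class a (f x) N.
Proof. by rewrite !rmorphM !rmorph_parts_prod !rmorph_poch. Qed.

Lemma rmorph_middle_class : f (middle_class x N) = middle_class (f x) N.
Proof. by rewrite rmorphM !rmorph_parts_prod. Qed.
End Morphisms.

(** The test ring is the quotient of the polynomials by X^N, where the class of
a polynomial determines its coefficients below N. *)
Lemma eq_coef_nilpotent (p q : {poly int}) N :
  (forall (R : comNzRingType) (f : {rmorphism {poly int} -> R}),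
     f 'X ^+ N = 0 -> f p = f q) ->
  forall i, (i < N)%N -> p`_i = q`_i.
Proof.
move=> pq i iN; pose h : {poly int} := 'X^N.
have hm : mk_monic h = 'X^N.
  rewrite /mk_monic /h size_polyXn monicXn andbT ltnS ifT //; lia.
have := pq _ (in_qpoly h : {rmorphism {poly int} -> {poly %/ h}}).
rewrite -rmorphXn.
have E (r : {poly int}) : (in_qpoly h r : {poly int}) = Pdiv.CommonRing.rmodp r 'X^N.
  by rewrite /= hm.
have f0 : in_qpoly h 'X^N = 0.
  by apply: val_inj; rewrite /= hm Pdiv.RingMonic.rmodpp ?monicXn.
move=> /(_ f0) /(congr1 (fun r : {poly %/ h} => (r : {poly int}))).
rewrite !E => pqE.
have M : 'X^N \is @monic int by rewrite monicXn.
rewrite (Pdiv.RingMonic.rdivp_eq M p) (Pdiv.RingMonic.rdivp_eq M q) pqE.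
by rewrite !coefD !coefMXn iN.
Qed.

(** * Positivity of the coefficients *)

Definition nneg_coefs (p : {poly int}) := forall i, 0 <= p`_i.

Lemma nneg_coefsXn n : nneg_coefs 'X^n.
Proof. by move=> i; rewrite coefXn. Qed.

Lemma nneg_coefs1 : nneg_coefs 1.
Proof. exact: nneg_coefsXn 0%N. Qed.

Lemma nneg_coefsD p q : nneg_coefs p -> nneg_coefs q -> nneg_coefs (p + q).
Proof. by move=> p0 q0 i; rewrite coefD addr_ge0. Qed.

Lemma nneg_coefsM p q : nneg_coefs p -> nneg_coefs q -> nneg_coefs (p * q).
Proof.
by move=> p0 q0 n; rewrite coefM; apply: sumr_ge0 => i _; apply: mulr_ge0.
Qed.

Lemma coefM_gt0 p q n : nneg_coefs p -> nneg_coefs q ->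
  0 < p`_n -> 0 < q`_0 -> 0 < (p * q)`_n.
Proof.
move=> p0 q0 pn qn; rewrite coefM big_ord_recr /= subnn.
apply: ltr_wpDl; last exact: mulr_gt0.
by apply: sumr_ge0 => i _; apply: mulr_ge0.
Qed.

Lemma geom_nneg N i : nneg_coefs (geom 'X N i).
Proof.
by move=> n; rewrite coef_sum; apply: sumr_ge0 => k _; rewrite nneg_coefsXn.
Qed.

Lemma nneg_coefs_prod (I : Type) (r : seq I) (P : pred I) (F : I -> {poly int}) :
  (forall i, P i -> nneg_coefs (F i)) -> nneg_coefs (\prod_(i <- r | P i) F i).
Proof.
by move=> F0; apply: big_ind => //; [exact: nneg_coefs1|exact: nneg_coefsM].
Qed.

Lemma parts_prod_nneg N P : nneg_coefs (parts_prod 'X N P).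
Proof. by apply: nneg_coefs_prod => i _; exact: geom_nneg. Qed.

Lemma poch_nneg N a b : nneg_coefs (poch 'X N 1 a b).
Proof.
apply: nneg_coefs_prod => i _; rewrite mul1r.
by apply: nneg_coefsD; [exact: nneg_coefs1|exact: nneg_coefsXn].
Qed.

Lemma geom_coef0 N i : (0 < i)%N -> (0 < N)%N -> (geom ('X : {poly int}) N i).[0] = 1.
Proof.
case: N => // N i0 _; rewrite horner_sum big_ord_recl /= muln0 hornerXn expr0 big1 ?addr0 //.
by move=> k _; rewrite hornerXn expr0n muln_eq0; case: i i0.
Qed.

Lemma parts_prod_coef0 N P : (0 < N)%N -> (parts_prod ('X : {poly int}) N P).[0] = 1.
Proof.
move=> N0; rewrite horner_prod big_nat_cond big1 // => i /andP[/andP[i0 _] _].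
exact: geom_coef0.
Qed.

Lemma poch_coef0 N a b : (0 < a)%N -> (poch ('X : {poly int}) N 1 a b).[0] = 1.
Proof.
move=> a0; rewrite horner_prod big1 // => i _.
by rewrite mul1r hornerD hornerC hornerXn expr0n addn_eq0; case: a a0.
Qed.

(** The parts equal to 1 contribute the factor 1 + X + ... + X^(N-1), whose
coefficients are all positive below N, and the other factors have constant
term 1.  The bound 1 < N ensures that the part 1 is present. *)
Lemma parts_prod_coef_gt0 N n : (n < N)%N -> (1 < N)%N ->
  0 < (parts_prod ('X : {poly int}) N xpredT)`_n.
Proof.
move=> nN N1; rewrite /parts_prod big_ltn //; apply: coefM_gt0.
- exact: geom_nneg.
- by apply: nneg_coefs_prod => i _; exact: geom_nneg.
- rewrite /geom; under eq_bigr do rewrite mul1n.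
  rewrite coef_sum (bigD1 (Ordinal nN)) //= coefXn eqxx ltr_wpDr //.
  by apply: sumr_ge0 => i _; rewrite coefXn.
rewrite -horner_coef0 horner_prod big_nat_cond big1 // => i /andP[/andP[i0 _] _].
by apply: geom_coef0; lia.
Qed.

Lemma outer_class_coef_gt0 a N n : (0 < a < 5)%N -> (n < N)%N -> (1 < N)%N ->
  0 < (outer_class a ('X : {poly int}) N)`_n.
Proof.
move=> a5 nN N1; apply: coefM_gt0; first exact: parts_prod_nneg.
- apply: nneg_coefsM; first exact: parts_prod_nneg.
  by apply: nneg_coefsM; exact: poch_nneg.
- exact: parts_prod_coef_gt0.
rewrite -horner_coef0 !hornerM parts_prod_coef0 ?poch_coef0 ?mulr1 //; lia.
Qed.

Lemma middle_class_coef_gt0 N n : (n < N)%N -> (1 < N)%N ->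
  0 < (middle_class ('X : {poly int}) N)`_n.
Proof.
move=> nN N1; apply: coefM_gt0; try exact: parts_prod_nneg.
  exact: parts_prod_coef_gt0.
by rewrite -horner_coef0 parts_prod_coef0 //; lia.
Qed.

(** * The generating function of two-coloured partitions *)

(** Expanding the product of the geometric sums, with one factor for each color
and each part size, chooses one multiplicity per factor, that is a function
counted by [p2] when the total size is n. *)
Lemma p2_prod n :
  (p2 n)%:Z = (parts_prod ('X : {poly int}) n.+1 xpredT * parts_prod 'X n.+1 xpredT)`_n.
Proof.
have -> : parts_prod ('X : {poly int}) n.+1 xpredT * parts_prod 'X n.+1 xpredT =
    \prod_(cj : 'I_2 * 'I_n) \sum_(k : 'I_n.+1) 'X^(k * cj.2.+1).
  rewrite -(pair_bigA _ (fun (c : 'I_2) (j : 'I_n) => \sum_(k : 'I_n.+1) 'X^(k * j.+1))) /=.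
  rewrite big_ord_recl big_ord1 /parts_prod big_add1 big_mkord.
  by congr (_ * _); apply: eq_bigr => j _; apply: eq_bigr => k _; rewrite mulnC.
rewrite bigA_distr_bigA /= coef_sum /p2 -sum1_card -natz natr_sum big_mkcond /=.
apply: eq_bigr => f _; rewrite inE.
have -> : \prod_i 'X^(f i * i.2.+1) = 'X^(\sum_cj f cj * cj.2.+1) :> {poly int}.
  by rewrite (big_morph _ (exprD 'X) (expr0 'X)).
by rewrite coefXn eq_sym; case: eqP.
Qed.

(** In a ring where x^(n+1) = 0 the truncations at n + 1 and at M are inverse
to the same product, hence equal. *)
Lemma p2_coef n M : (n < M)%N ->
  (p2 n)%:Z = (parts_prod ('X : {poly int}) M xpredT * parts_prod 'X M xpredT)`_n.
Proof.
move=> nM; rewrite p2_prod; apply: (@eq_coef_nilpotent _ _ n.+1) => // R f fX.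
rewrite !rmorphM !rmorph_parts_prod.
suff -> : parts_prod (f 'X) n.+1 xpredT = parts_prod (f 'X) M xpredT by [].
have fM : f 'X ^+ M = 0 by rewrite (nilpotent_expr fX).
rewrite -[LHS]mulr1 -(euler_prodK fM xpredT) mulrA /euler_prod (euler_prod_widen fX xpredT nM).
by rewrite [parts_prod _ n.+1 _ * _]mulrC euler_prodK ?mul1r.
Qed.

(** * The 5-dissection *)

Section Dissection.
Variables (R : comNzRingType) (x : R) (N : nat).
Hypothesis xN : x ^+ N = 0.

(** [quad 1 3] is the pentagonal exponent; the hypothesis is the doubled
conclusion, free of triangular numbers, so that it can be checked as a
polynomial identity. *)
Lemma quad13_class (s t : int) a b c d :
  3 * (s * (s - 1)) + s * 2 =
    d%:Z * 2 + 5 * (b%:Z * (t * (t - 1)) + a%:Z * t * 2 + c%:Z * 2) ->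
  quad 1 3 s = d%:Z + 5 * (quad a b t + c%:Z).
Proof. by have := quadE 1 3 s; have := quadE a b t; lia. Qed.

(** One residue class of the pentagonal series, parametrized by s: d is the
residue of its exponents modulo 5, and e is the parity shift between t and
[s t]. *)
Lemma zsum_theta_class (s : int -> int) a b c d e :
  (forall t, quad 1 3 (s t) = d%:Z + 5 * (quad a b t + c%:Z)) ->
  (forall t, `|t| <= quad a b t + c%:Z) ->
  (forall t, odd `|s t| = odd (`|t| + e)) ->
  \zsum_t theta x (-1) 1 3 (s t) = (-1) ^+ e * x ^+ d *
    \zsum_t ((-1) ^+ `|t| * (x ^+ 5) ^+ `|quad a b t + c%:Z|).
Proof.
move=> sE bound parity; rewrite -(@zsum_scale _ N) => [|t Nt]; last first.
  by rewrite -exprM (nilpotent_expr xN) ?mulr0 //; have := bound t; lia.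
apply: eq_fsbigr => t _; rewrite /theta.
rewrite (@sign_exp_parity _ _ _ _ _ (parity t)) ?mulrNN ?mulr1 //.
have -> : `|quad 1 3 (s t)|%N = (d + 5 * `|(quad a b t + c%:Z)%R|)%N.
  by have := sE t; have := bound t; lia.
by rewrite (exprD (-1)) (exprD x d) exprM; ring.
Qed.

Lemma zsum_theta_class0 (s : int -> int) a b d e :
  (forall t, quad 1 3 (s t) = d%:Z + 5 * (quad a b t + 0%:Z)) ->
  (forall t, `|t| <= quad a b t) ->
  (forall t, odd `|s t| = odd (`|t| + e)) ->
  \zsum_t theta x (-1) 1 3 (s t) =
    (-1) ^+ e * x ^+ d * \zsum_t theta (x ^+ 5) (-1) a b t.
Proof.
move=> sE bound parity; rewrite (@zsum_theta_class s a b 0 d e) => // [|t].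
- by congr (_ * _); apply: eq_fsbigr => t _; rewrite addr0.
- by rewrite addr0.
Qed.

(** The classes m = 0 and m = 2 modulo 5 have exponents in 5Z, the class m = 1
has exponents in 1 + 5Z, and the classes m = 3 and m = 4 have exponents in
2 + 5Z. *)
Lemma pentagonal_dissection (y := x ^+ 5) :
  \zsum_m theta x (-1) 1 3 m =
  (\zsum_t theta y (-1) (5 + 3 * 1) 15 t + \zsum_t theta_tail y 1 5 t)
  - x * (\zsum_t theta y (-1) 10 15 t)
  - x ^+ 2 * (\zsum_t theta y (-1) (5 + 3 * 2) 15 t + \zsum_t theta_tail y 2 5 t).
Proof.
rewrite (@zsum_split _ 5 N) //; last by move=> m Nm; rewrite (theta_eq0 xN) // ltnW.
pose F (r : nat) := \zsum_t theta x (-1) 1 3 (5%:Z * t + r%:Z).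
(* Here and for m = 4 the index runs backwards, m = -5t and m = -1 - 5t, to
   meet the orientation of the quintuple product series. *)
have F0 : F 0%N = (-1) ^+ 0 * x ^+ 0 * \zsum_t theta y (-1) 8 15 t.
  rewrite /F zsum_opp; apply: zsum_theta_class0 => t.
  - by apply: quad13_class; lia.
  - by have := @le_quad 8 15 t isT; lia.
  - by lia.
have F1 : F 1%N = (-1) ^+ 1 * x ^+ 1 * \zsum_t theta y (-1) 10 15 t.
  apply: zsum_theta_class0 => t.
  - by apply: quad13_class; lia.
  - by have := @le_quad 10 15 t isT; lia.
  - by lia.
have F2 : F 2%N = (-1) ^+ 0 * x ^+ 0 * \zsum_t theta_tail y 1 5 t.
  apply: zsum_theta_class => t.
  - by apply: quad13_class; lia.
  - exact: (@le_quad_tail 1 5 t isT isT).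
  - by lia.
have F3 : F 3%N = (-1) ^+ 1 * x ^+ 2 * \zsum_t theta_tail y 2 5 t.
  apply: zsum_theta_class => t.
  - by apply: quad13_class; lia.
  - exact: (@le_quad_tail 2 5 t isT isT).
  - by lia.
have F4 : F 4%N = (-1) ^+ 1 * x ^+ 2 * \zsum_t theta y (-1) 11 15 t.
  rewrite /F zsum_opp (zsum_shift 1); apply: zsum_theta_class0 => t.
  - by apply: quad13_class; lia.
  - by have := @le_quad 11 15 t isT; lia.
  - by lia.
rewrite -(big_mkord xpredT F) !big_nat_recr //= big_geq // F0 F1 F2 F3 F4.
rewrite !expr0 !expr1 [RHS]/=; ring.
Qed.
End Dissection.

Definition pent (m : int) : nat := `|quad 1 3 m|.

Lemma P5E m : P5 m = (pent m)%:R.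
Proof.
have q0 := @quad_ge0 1 3 m isT; have qE := quadE 1 3 m.
rewrite /P5 /pent; apply: (@mulIf _ (2 : rat)) => //; rewrite divfK //.
have -> : `|quad 1 3 m|%:R * 2 = (quad 1 3 m * 2)%:~R :> rat.
  by rewrite rmorphM /= -{2}(gez0_abs q0).
by rewrite qE !(rmorphD, rmorphM, rmorphB, rmorphXn) /=; ring.
Qed.

Lemma pent_termE n m : pent_term n m = (-1) ^+ `|m| *
  (if (pent m <= n)%N && (5 %| n - pent m)%N then (p2 ((n - pent m) %/ 5))%:Z else 0).
Proof.
rewrite /pent_term P5E; congr (_ * _).
  case: m => m //; rewrite NegzE exprzN -exprnP invr_sign; congr (_ ^+ _).
rewrite /p2Q -[n%:~R]/(n%:R).
case: (boolP ((pent m <= n) && (5 %| n - pent m))%N) => [/andP[le_n d5]|H].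
  have -> : (n%:R - (pent m)%:R) / 5 = ((n - pent m) %/ 5)%:R :> rat.
    have nE : n = (pent m + (n - pent m) %/ 5 * 5)%N by rewrite divnK // subnKC.
    by rewrite {1}nE natrD natrM addrC addKr mulfK.
  by rewrite natr_nat natrK.
case: ifP => // /natrP[k kE].
have : n%:R = (pent m + 5 * k)%:R :> rat.
  rewrite natrD natrM -kE mulrC divfK //; ring.
move/eqP; rewrite eqr_nat => /eqP nE; move: H; rewrite nE.
by rewrite leq_addr addKn dvdn_mulr.
Qed.

Lemma pent_sum_coef n N : (n < N)%N ->
  pent_sum n = ((\sum_(m <- zrange N) theta 'X (-1) 1 3 m) *
    ((parts_prod 'X N xpredT * parts_prod 'X N xpredT) \Po 'X^5))`_n.
Proof.
move=> nN; rewrite /pent_sum (@zsumE _ N); last first.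
  move=> m; apply: contraTeq => /pent_term_neq0; lia.
rewrite big_distrl coef_sum; apply: eq_bigr => m _ /=.
rewrite pent_termE /theta -signr_odd -[in RHS]signr_odd -mulrA.
have -> : (-1) ^+ odd `|m| = ((-1) ^+ odd `|m|)%:P :> {poly int}.
  by rewrite rmorphXn rmorphN1.
rewrite coefCM; congr (_ * _); rewrite coefXnM -/(pent m) ltnNge.
case: leqP => //= le_n; rewrite coef_comp_poly_Xn //; case: ifP => // d5.
by apply: p2_coef; rewrite (leq_ltn_trans _ nN) // (leq_trans (leq_div _ _)) ?leq_subr.
Qed.

Lemma pent_sum_dissection n N : (n < N)%N ->
  pent_sum n = ((outer_class 1 'X N \Po 'X^5) - 'X * (middle_class 'X N \Po 'X^5) -
    'X^2 * (outer_class 2 'X N \Po 'X^5))`_n.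
Proof.
move=> nN; rewrite (pent_sum_coef nN).
apply: (eq_coef_nilpotent (N := N)) nN => R f fX.
pose x := f 'X; pose y := x ^+ 5.
have yN : y ^+ N = 0 by rewrite /y -exprM mulnC exprM fX expr0n.
pose g : {rmorphism {poly int} -> R} := f \o comp_poly 'X^5.
have gX : g 'X = y by rewrite /g /= comp_polyX rmorphXn.
have gE p : f (p \Po 'X^5) = g p by [].
have fE (p q r : {poly int}) : f (p - 'X * q - 'X^2 * r) = f p - x * f q - x ^+ 2 * f r.
  by rewrite !rmorphB (rmorphM f 'X) (rmorphM f 'X^2) (rmorphXn f).
rewrite {}fE (rmorphM f) !gE rmorph_sum.
rewrite !rmorph_outer_class !rmorph_middle_class rmorphM !rmorph_parts_prod gX.
under eq_bigr do rewrite rmorph_theta.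
rewrite -zsumE => [|m Nm]; last by rewrite (theta_eq0 fX) // ltnW.
rewrite (pentagonal_dissection fX) -/x -/y -!(quintuple_quotient yN) //.
rewrite -(pentagonal_quotient yN); ring.
Qed.

Theorem corollary1p2 (n : nat) (hn : (0 < n)%N) :
  [/\ (n = 0 %[mod 5])%N -> 0 < pent_sum n,
      (n = 1 %[mod 5])%N \/ (n = 2 %[mod 5])%N -> pent_sum n < 0
    & (n = 3 %[mod 5])%N \/ (n = 4 %[mod 5])%N -> pent_sum n = 0].
Proof.
(* The truncation index must exceed n, and exceed 1 even when n is small. *)
have nN : (n < n.+2)%N by lia.
have n5 : (n %/ 5 < n.+2)%N by lia.
have := pent_sum_dissection nN; rewrite !coefB coefXM coefXnM !coef_comp_poly_Xn // => E.
have A0 (a : nat) : (0 < a < 5)%N ->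
    forall k, (k < n.+2)%N -> 0 < (outer_class a ('X : {poly int}) n.+2)`_k.
  by move=> a5 k kn; apply: outer_class_coef_gt0.
have B0 k : (k < n.+2)%N -> 0 < (middle_class ('X : {poly int}) n.+2)`_k.
  by move=> kn; apply: middle_class_coef_gt0.
split=> [n0|n12|n34]; rewrite {}E.
- rewrite ifT; last by lia.
  rewrite (_ : (if n == 0%N then _ else _) = 0); last by case: eqP => // ?; rewrite ifF //; lia.
  rewrite (_ : (if (n < 2)%N then _ else _) = 0); last by case: ltnP => // ?; rewrite ifF //; lia.
  by rewrite !subr0 A0.
- rewrite ifF; last by lia.
  rewrite [n == 0%N]gtn_eqF //; case: n12 => n12.
    rewrite ifT; last by lia.
    rewrite (_ : (if (n < 2)%N then _ else _) = 0); last by case: ltnP => // ?; rewrite ifF //; lia.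
    by rewrite subr0 sub0r oppr_lt0 B0 //; lia.
  rewrite ifF; last by lia.
  rewrite ifF; last by lia.
  rewrite ifT; last by lia.
  by rewrite subr0 sub0r oppr_lt0 A0 //; lia.
rewrite ifF; last by lia.
rewrite [n == 0%N]gtn_eqF // ifF; last by lia.
rewrite ifF; last by lia.
by rewrite ifF ?subr0 //; lia.
Qed.
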